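(* Let $H_1,\dots,H_n$ be quasitriangular Hopf algebras with universal $R$-matrices $\mathscr R_{H_1},\dots,\mathscr R_{H_n}$, and for each $i$ let $T_i$ be a representation of $H_i$ on an $m_i$-dimensional vector space $V_i$ with a fixed basis. Let $R_{V_i}=(T_i\otimes T_i)(\mathscr R_{H_i})$ be the associated $R$-matrix, and let $R_{V_1\otimes\cdots\otimes V_n}$ be the $R$-matrix of the representation $V_1\otimes\cdots\otimes V_n$ of the quasitriangular Hopf algebra $H_1\otimes\cdots\otimes H_n$, with respect to the tensor product basis. Then for all multi-indices $\underline i=(i_1,\dots,i_n)$, $\underline j$, $\underline k$, $\underline l$, $$(R_{V_1\otimes\cdots\otimes V_n})^{\underline i\,\underline j}_{\underline k\,\underline l}=(R_{V_1})^{i_1j_1}_{k_1l_1}(R_{V_2})^{i_2j_2}_{k_2l_2}\cdots(R_{V_n})^{i_nj_n}_{k_nl_n}.$$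
   Context: For a quasitriangular Hopf algebra $H$ write $\mathscr R_H=\mathscr R_H^1\otimes\mathscr R_H^2$ (summation understood). The tensor product Hopf algebra $H_1\otimes\cdots\otimes H_n$ (factorwise operations) is quasitriangular with universal $R$-matrix $$\mathscr R_{H_1\otimes\cdots\otimes H_n}=(\mathscr R^1_{H_1}\otimes\cdots\otimes\mathscr R^1_{H_n})\otimes(\mathscr R^2_{H_1}\otimes\cdots\otimes\mathscr R^2_{H_n}).$$ The representation $T_{V_1\otimes\cdots\otimes V_n}$ of $H_1\otimes\cdots\otimes H_n$ on $V_1\otimes\cdots\otimes V_n$ is the factorwise action $(h_1\otimes\cdots\otimes h_n)(v_1\otimes\cdots\otimes v_n)=T_1(h_1)v_1\otimes\cdots\otimes T_n(h_n)v_n$, and $R_{V_1\otimes\cdots\otimes V_n}=(T_{V_1\otimes\cdots\otimes V_n}\otimes T_{V_1\otimes\cdots\otimes V_n})(\mathscr R_{H_1\otimes\cdots\otimes H_n})$. Matrix entries: for a vector space $V$ with basis $(v_i)$ and an operator $R$ on $V\otimes V$, $R(v_k\otimes v_l)=\sum_{i,j}R^{ij}_{kl}\,v_i\otimes v_j$, i.e. $R^{ij}_{kl}$ is the entry in row $(i,j)$ and column $(k,l)$. For $V=V_1\otimes\cdots\otimes V_n$ the basis vectors are $v_{i_1}\otimes\cdots\otimes v_{i_n}$, indexed by multi-indices $\underline i=(i_1,\dots,i_n)$ with $1\le i_k\le m_k$. *)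

(* Defs.v *)
From HB Require Import structures.
From mathcomp Require Import all_boot all_order all_algebra.
From mathcomp Require Import generic_quotient.
From mathcomp Require Import boolp classical_sets.

Set Implicit Arguments.
Unset Strict Implicit.
Unset Printing Implicit Defensive.

Import GRing.Theory.
Local Open Scope ring_scope.
Local Open Scope quotient_scope.

Definition multilinear (K : fieldType) (I : finType) (V : I -> lmodType K)
    (W : lmodType K) (f : (forall i, V i) -> W) : Prop :=
  forall (i : I) (x : forall i, V i) (a : K) (u v : V i),
    f (dfwith x (a *: u + v)) = a *: f (dfwith x u) + f (dfwith x v).

Section TensorProduct.
Variables (K : fieldType) (I : finType) (V : I -> lmodType K).

Definition formal_sum := seq (K * (forall i, V i)).

Definition feval (W : lmodType K) (f : (forall i, V i) -> W)
    (s : formal_sum) : W := \sum_(p <- s) p.1 *: f p.2.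

(* tens is the quotient of the formal linear combinations of families by the
   relations of multilinearity, given here by the universal property: two
   combinations are identified when no multilinear map separates them. *)
Definition tens_equiv (s t : formal_sum) : Prop :=
  forall (W : lmodType K) (f : (forall i, V i) -> W),
    multilinear f -> feval f s = feval f t.

Definition tens_rel : rel formal_sum := fun s t => `[< tens_equiv s t >].

Fact tens_rel_refl : reflexive tens_rel.
Proof. by move=> s; apply/asboolP. Qed.

Fact tens_rel_sym : symmetric tens_rel.
Proof. by move=> s t; apply/asboolP/asboolP => e W f /e. Qed.

Fact tens_rel_trans : transitive tens_rel.
Proof.
by move=> t s u /asboolP e1 /asboolP e2; apply/asboolP => W f mf; rewrite e1// e2.
Qed.

Canonical tens_equiv_rel :=
  EquivRel tens_rel tens_rel_refl tens_rel_sym tens_rel_trans.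

Definition tens : Type := {eq_quot tens_equiv_rel}.
HB.instance Definition _ := Choice.on tens.
HB.instance Definition _ := EqQuotient.on tens.

Definition pure (x : forall i, V i) : tens := \pi_tens [:: (1, x)].

(* The linear extension of f: if t = \sum_p c_p (x_p1 (x) ... (x) x_pn) then
   tlift f t = \sum_p c_p f (x_p1, ..., x_pn), which does not depend on the
   decomposition of t as soon as f is multilinear (tlift_pi below). *)
Definition tlift (W : lmodType K) (f : (forall i, V i) -> W) (t : tens) : W :=
  feval f (repr t).

Lemma tlift_pi (W : lmodType K) (f : (forall i, V i) -> W) s :
  multilinear f -> tlift f (\pi_tens s) = feval f s.
Proof.
move=> mf; rewrite /tlift.
have : repr (\pi_tens s) = s %[mod tens] by rewrite reprK.
by move/eqmodP/asboolP/(_ W f mf).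
Qed.

Lemma tens_eq (t u : tens) :
  (forall (W : lmodType K) (f : (forall i, V i) -> W),
     multilinear f -> tlift f t = tlift f u) -> t = u.
Proof.
move=> e; rewrite -[t]reprK -[u]reprK; apply/eqmodP/asboolP => W f mf.
exact: e.
Qed.

Definition tens_zero : tens := \pi_tens [::].
Definition tens_add (t u : tens) : tens := \pi_tens (repr t ++ repr u).
Definition tens_scale (a : K) (t : tens) : tens :=
  \pi_tens [seq (a * p.1, p.2) | p <- repr t].
Definition tens_opp (t : tens) : tens := tens_scale (- 1) t.

Section LiftOps.
Variables (W : lmodType K) (f : (forall i, V i) -> W) (mf : multilinear f).

Lemma tlift_zero : tlift f tens_zero = 0.
Proof. by rewrite tlift_pi// /feval big_nil. Qed.

Lemma tlift_add t u : tlift f (tens_add t u) = tlift f t + tlift f u.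
Proof. by rewrite tlift_pi// /feval big_cat. Qed.

Lemma tlift_scale a t : tlift f (tens_scale a t) = a *: tlift f t.
Proof.
rewrite tlift_pi// /tlift /feval big_map scaler_sumr.
by apply: eq_bigr => p _; rewrite scalerA.
Qed.

Lemma tlift_opp t : tlift f (tens_opp t) = - tlift f t.
Proof. by rewrite tlift_scale scaleN1r. Qed.

Lemma tlift_pure x : tlift f (pure x) = f x.
Proof. by rewrite tlift_pi// /feval big_seq1 scale1r. Qed.

End LiftOps.

Fact tens_addA : associative tens_add.
Proof. by move=> t u v; apply: tens_eq => W f mf; rewrite !tlift_add// addrA. Qed.
Fact tens_addC : commutative tens_add.
Proof. by move=> t u; apply: tens_eq => W f mf; rewrite !tlift_add// addrC. Qed.
Fact tens_add0 : left_id tens_zero tens_add.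
Proof.
by move=> t; apply: tens_eq => W f mf; rewrite tlift_add// tlift_zero// add0r.
Qed.
Fact tens_addN : left_inverse tens_zero tens_opp tens_add.
Proof.
move=> t; apply: tens_eq => W f mf.
by rewrite tlift_add// tlift_opp// tlift_zero// addNr.
Qed.

HB.instance Definition _ :=
  GRing.isZmodule.Build tens tens_addA tens_addC tens_add0 tens_addN.

Fact tens_scaleA a b t : tens_scale a (tens_scale b t) = tens_scale (a * b) t.
Proof. by apply: tens_eq => W f mf; rewrite !tlift_scale// scalerA. Qed.
Fact tens_scale1 : left_id 1 tens_scale.
Proof. by move=> t; apply: tens_eq => W f mf; rewrite tlift_scale// scale1r. Qed.
Fact tens_scaleDr : right_distributive tens_scale +%R.
Proof.
move=> a t u; apply: tens_eq => W f mf.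
by rewrite tlift_add// !tlift_scale// tlift_add// scalerDr.
Qed.
Fact tens_scaleDl t : {morph tens_scale^~ t : a b / a + b}.
Proof.
move=> a b; apply: tens_eq => W f mf.
by rewrite tlift_add// !tlift_scale// scalerDl.
Qed.

HB.instance Definition _ := GRing.Zmodule_isLmodule.Build K tens
  tens_scaleA tens_scale1 tens_scaleDr tens_scaleDl.

Lemma tlift_linear (W : lmodType K) (f : (forall i, V i) -> W) :
  multilinear f -> linear (tlift f).
Proof. by move=> mf a t u; rewrite tlift_add// tlift_scale. Qed.

Lemma pure_multilinear : multilinear pure.
Proof.
move=> i x a u v; apply: tens_eq => W f mf.
by rewrite tlift_linear// !tlift_pure.
Qed.

Lemma tens_pureE t : t = \sum_(p <- repr t) p.1 *: pure p.2.
Proof.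
apply: tens_eq => W f mf; rewrite {1}/tlift /feval.
elim: (repr t) => [|p s IH]; first by rewrite !big_nil tlift_zero.
by rewrite !big_cons tlift_linear// tlift_pure// IH.
Qed.

Lemma tens_ind (P : tens -> Prop) :
  P 0 -> (forall a t u, P t -> P u -> P (a *: t + u)) ->
  (forall x, P (pure x)) -> forall t, P t.
Proof.
move=> P0 PD Pp t; rewrite [t]tens_pureE.
elim: (repr t) => [|p s IH]; first by rewrite big_nil.
by rewrite big_cons; apply: PD.
Qed.

End TensorProduct.

Lemma linearPt (K : fieldType) (V W : lmodType K) (f : V -> W) :
  linear f -> (f 0 = 0) * (forall a u v, f (a *: u + v) = a *: f u + f v).
Proof.
move=> lf; split=> //.
by have := lf (-1) 0 0; rewrite scaler0 addr0 scaleN1r addNr.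
Qed.

Section Multilinear.
Variables (K : fieldType) (I : finType).

Lemma dfwith_map (V U : I -> Type) (g : forall i, V i -> U i) x i (u : V i) :
  (fun j => g j (dfwith x u j)) = dfwith (fun j => g j (x j)) (g i u).
Proof.
apply: functional_extensionality_dep => j.
case: (eqVneq i j) => [<-|ij]; first by rewrite !dfwith_in.
by rewrite !dfwith_out.
Qed.

Lemma dfwith_same (V : I -> Type) (x : forall i, V i) i : dfwith x (x i) = x.
Proof.
apply: functional_extensionality_dep => j.
by case: (eqVneq i j) => [<-|ij]; rewrite ?dfwith_in ?dfwith_out.
Qed.

Lemma dfwithC (V : I -> Type) (x : forall i, V i) i j (u : V i) (v : V j) :
  i != j -> dfwith (dfwith x u) v = dfwith (dfwith x v) u.
Proof.
move=> ij; apply: functional_extensionality_dep => k.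
case: (eqVneq i k) => [<-|ik].
  by rewrite dfwith_in dfwith_out 1?eq_sym// dfwith_in.
case: (eqVneq j k) => [<-|jk]; first by rewrite dfwith_in dfwith_out// dfwith_in.
by rewrite !dfwith_out.
Qed.

Lemma multilinear_comp (V U : I -> lmodType K) (W : lmodType K)
    (g : forall i, V i -> U i) (f : (forall i, U i) -> W) :
  (forall i, linear (g i)) -> multilinear f ->
  multilinear (fun x => f (fun i => g i (x i))).
Proof. by move=> lg mf i x a u v; rewrite !dfwith_map lg mf. Qed.

Lemma multilinear_post (V : I -> lmodType K) (U W : lmodType K)
    (f : (forall i, V i) -> U) (h : U -> W) :
  multilinear f -> linear h -> multilinear (fun x => h (f x)).
Proof. by move=> mf lh i x a u v; rewrite mf lh. Qed.

Lemma tlift_comb (V : I -> lmodType K) (W : lmodType K) a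
    (f g h : (forall i, V i) -> W) (t : tens V) :
  (forall x, h x = a *: f x + g x) -> tlift h t = a *: tlift f t + tlift g t.
Proof.
move=> e; rewrite /tlift /feval scaler_sumr -big_split; apply: eq_bigr => p _ /=.
by rewrite e scalerDr !scalerA mulrC.
Qed.

Lemma multilinear_ext (J : I -> finType) (A : forall i, J i -> lmodType K)
    (W : lmodType K) (f g : (forall i, tens (A i)) -> W) :
  multilinear f -> multilinear g ->
  (forall y : forall i j, A i j,
     f (fun i => pure (y i)) = g (fun i => pure (y i))) ->
  forall t, f t = g t.
Proof.
move=> mf mg fg.
suff H (s : seq I) (t : forall i, tens (A i)) :
    (forall i, i \notin s -> exists y, t i = pure y) -> f t = g t.
  by move=> t; apply: (H (enum I)) => i; rewrite mem_enum.
elim: s t => [|i s IH] t ht.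
  have c i := cid (ht i isT).
  rewrite (_ : t = fun i => pure (sval (c i))) //.
  by apply: functional_extensionality_dep => i; case: (c i).
rewrite -(dfwith_same t i); elim/tens_ind: (t i) => [|a u v IHu IHv|x].
- have := mf i t (-1) 0 0; have := mg i t (-1) 0 0.
  by rewrite scaler0 addr0 !scaleN1r !addNr => -> ->.
- by rewrite mf mg IHu IHv.
- apply: IH => j js; case: (eqVneq i j) => [<-|ij].
    by exists x; rewrite dfwith_in.
  by rewrite dfwith_out//; apply: ht; rewrite inE negb_or eq_sym ij.
Qed.

Lemma tens_lin_ext (V : I -> lmodType K) (W : lmodType K) (f g : tens V -> W) :
  linear f -> linear g -> (forall x, f (pure x) = g (pure x)) ->
  forall t, f t = g t.
Proof.
move=> lf lg fg; elim/tens_ind => [|a t u IHt IHu|//].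
  by rewrite !(linearPt _).1.
by rewrite lf lg IHt IHu.
Qed.

End Multilinear.

Section Shuffle.
Variables (K : fieldType) (I J : finType) (A : I -> J -> lmodType K).

(* The map taking the tensors t_i = \sum y_i1 (x) ... (x) y_ir, i in I, to
   \sum (x)_j (x)_i y_ij is shuffle, see shuffle_pure and shuffle_multilinear.
   It is computed by nested summation over decompositions of the tensors t i, i in s:
   shuffle_rec s t x has x i in place of y_i for i outside s. *)
Fixpoint shuffle_rec (s : seq I) (t : forall i, tens (A i)) (x : forall i j, A i j)
    : tens (fun j => tens (fun i => A i j)) :=
  if s is i :: s' then tlift (fun y => shuffle_rec s' t (dfwith x y)) (t i)
  else pure (fun j => pure (fun i => x i j)).

Definition shuffle (t : forall i, tens (A i)) : tens (fun j => tens (fun i => A i j)) :=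
  shuffle_rec (enum I) t (fun i j => 0).

Lemma shuffle_rec_multix s t i x : i \notin s ->
  multilinear (fun y : forall j, A i j => shuffle_rec s t (dfwith x y)).
Proof.
elim: s x => [|i' s IH] x /=; last first.
  rewrite inE negb_or => /andP[ii' is_] j y a u v.
  apply: tlift_comb => y'; rewrite !(dfwithC x _ y')//.
  exact: IH.
move=> _ j y a u v /=.
have E (w : A i j) : (fun j' => pure (fun i' => dfwith x (dfwith y w) i' j')) =
  dfwith (fun j' => pure (fun i' => dfwith x y i' j'))
         (pure (dfwith (fun i' => x i' j) w)).
  apply: functional_extensionality_dep => j'.
  case: (eqVneq j j') => [<-|jj']; last first.
    rewrite dfwith_out//; congr pure; apply: functional_extensionality_dep => i'.
    case: (eqVneq i i') => [<-|ii']; first by rewrite !dfwith_in dfwith_out.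
    by rewrite !dfwith_out.
  rewrite dfwith_in; congr pure; apply: functional_extensionality_dep => i'.
  case: (eqVneq i i') => [<-|ii']; first by rewrite !dfwith_in.
  by rewrite !dfwith_out.
by rewrite !E pure_multilinear pure_multilinear.
Qed.

Lemma shuffle_rec_out s t i (u : tens (A i)) x : i \notin s ->
  shuffle_rec s (dfwith t u) x = shuffle_rec s t x.
Proof.
elim: s x => [//|i' s IH] x /=; rewrite inE negb_or => /andP[ii' is_].
by rewrite dfwith_out//; congr tlift; apply/funext => y; rewrite IH.
Qed.

Lemma shuffle_rec_multit s i t x a (u v : tens (A i)) : uniq s -> i \in s ->
  shuffle_rec s (dfwith t (a *: u + v)) x =
    a *: shuffle_rec s (dfwith t u) x + shuffle_rec s (dfwith t v) x.
Proof.
elim: s x => [//|i' s IH] x /= /andP[i's us]; rewrite inE.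
case: (eqVneq i i') => [ii' _|ii' /= is_]; last first.
  by rewrite !dfwith_out//; apply: tlift_comb => y; exact: IH.
subst i'; rewrite !dfwith_in.
have E (w : tens (A i)) : (fun y : forall j, A i j => shuffle_rec s (dfwith t w) (dfwith x y)) =
           (fun y : forall j, A i j => shuffle_rec s t (dfwith x y)).
  by apply/funext => y; rewrite shuffle_rec_out.
by rewrite !E tlift_linear//; exact: shuffle_rec_multix.
Qed.

Lemma shuffle_multilinear : multilinear shuffle.
Proof.
by move=> i t a u v; apply: shuffle_rec_multit; rewrite ?enum_uniq ?mem_enum.
Qed.

Lemma shuffle_rec_pure s (y : forall i j, A i j) x : uniq s ->
  shuffle_rec s (fun i => pure (y i)) x =
  pure (fun j => pure (fun i => if i \in s then y i j else x i j)).
Proof.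
elim: s x => [//|i s IH] x /= /andP[is_ us].
rewrite tlift_pure; last exact: shuffle_rec_multix.
rewrite IH//; congr pure; apply: functional_extensionality_dep => j.
congr pure; apply: functional_extensionality_dep => i'; rewrite inE.
case: (eqVneq i' i) => [->|ii'] /=; first by rewrite (negPf is_) dfwith_in.
by case: ifP => // _; rewrite dfwith_out// eq_sym.
Qed.

Lemma shuffle_pure (y : forall i j, A i j) :
  shuffle (fun i => pure (y i)) = pure (fun j => pure (fun i => y i j)).
Proof.
rewrite /shuffle shuffle_rec_pure ?enum_uniq//; congr pure.
apply: functional_extensionality_dep => j; congr pure.
by apply: functional_extensionality_dep => i; rewrite mem_enum.
Qed.

End Shuffle.

Section TensorAlgebra.
Variables (K : fieldType) (I : finType) (A : I -> algType K).
Local Notation T := (tens (fun i => A i : lmodType K)).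

Definition tens_one : T := pure (fun i => 1).

Definition tens_mul (t u : T) : T :=
  tlift (fun x => tlift (fun y => pure (fun i => x i * y i)) u) t.

Fact mulr_linearl (i : I) (y : A i) : linear (fun x : A i => x * y).
Proof. by move=> a u v; rewrite mulrDl scalerAl. Qed.

Fact mulr_linearr (i : I) (x : A i) : linear (fun y : A i => x * y).
Proof. by move=> a u v; rewrite mulrDr scalerAr. Qed.

Fact pure_mul_multilinearr (x : forall i, A i) :
  multilinear (fun y : forall i, A i => pure (fun i => x i * y i) : T).
Proof.
apply: (multilinear_comp (g := fun i y => x i * y)); last exact: pure_multilinear.
by move=> i; exact: mulr_linearr.
Qed.

Fact pure_mul_multilinearl (u : T) :
  multilinear (fun x : forall i, A i => tlift (fun y => pure (fun i => x i * y i)) u).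
Proof.
move=> i x a v w; apply: tlift_comb => y.
apply: (multilinear_comp (g := fun i x => x * y i)); last exact: pure_multilinear.
by move=> j; exact: mulr_linearl.
Qed.

Lemma tens_mul_linearl u : linear (tens_mul^~ u).
Proof. exact: (tlift_linear (pure_mul_multilinearl u)). Qed.

Lemma tens_mul_linearr t : linear (tens_mul t).
Proof.
move=> a u v; apply: tlift_comb => x.
exact: (tlift_linear (pure_mul_multilinearr x)).
Qed.

Lemma tens_mul_pure x y :
  tens_mul (pure x) (pure y) = pure (fun i => x i * y i).
Proof.
rewrite /tens_mul tlift_pure; last exact: pure_mul_multilinearl.
by rewrite tlift_pure//; exact: pure_mul_multilinearr.
Qed.

Fact tens_mulA : associative tens_mul.
Proof.
move=> t u v.
apply: (tens_lin_ext (f := fun t => tens_mul t (tens_mul u v))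
                     (g := fun t => tens_mul (tens_mul t u) v)).
- exact: tens_mul_linearl.
- by move=> a ? ?; rewrite !tens_mul_linearl.
move=> x; apply: (tens_lin_ext (f := fun u => tens_mul (pure x) (tens_mul u v))
                     (g := fun u => tens_mul (tens_mul (pure x) u) v)).
- by move=> a ? ?; rewrite tens_mul_linearl tens_mul_linearr.
- by move=> a ? ?; rewrite tens_mul_linearr tens_mul_linearl.
move=> y; apply: (tens_lin_ext (f := fun v => tens_mul (pure x) (tens_mul (pure y) v))
                     (g := fun v => tens_mul (tens_mul (pure x) (pure y)) v)).
- by move=> a ? ?; rewrite !tens_mul_linearr.
- by move=> a ? ?; rewrite !tens_mul_linearr.
move=> z; rewrite !tens_mul_pure; congr pure.
by apply: functional_extensionality_dep => i; rewrite mulrA.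
Qed.

Fact tens_mul1l : left_id tens_one tens_mul.
Proof.
apply: tens_lin_ext => [||x]; [exact: tens_mul_linearr|by []|].
rewrite tens_mul_pure; congr pure.
by apply: functional_extensionality_dep => i; rewrite mul1r.
Qed.

Fact tens_mul1r : right_id tens_one tens_mul.
Proof.
apply: (tens_lin_ext (f := tens_mul^~ tens_one) (g := id)) => [||x].
- exact: tens_mul_linearl.
- by [].
rewrite tens_mul_pure; congr pure.
by apply: functional_extensionality_dep => i; rewrite mulr1.
Qed.

Fact tens_mulDl : left_distributive tens_mul +%R.
Proof.
by move=> t u v; have := tens_mul_linearl v 1 t u; rewrite !scale1r.
Qed.

Fact tens_mulDr : right_distributive tens_mul +%R.
Proof.
by move=> t u v; have := tens_mul_linearr t 1 u v; rewrite !scale1r.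
Qed.

HB.instance Definition _ := GRing.Zmodule_isPzRing.Build T
  tens_mulA tens_mul1l tens_mul1r tens_mulDl tens_mulDr.

Lemma tens_mulE (x y : forall i, A i) :
  (pure x : T) * pure y = pure (fun i => x i * y i).
Proof. exact: tens_mul_pure. Qed.

Lemma tens_scaleAl (a : K) (t u : T) : a *: (t * u) = (a *: t) * u.
Proof.
by have := tens_mul_linearl u a t 0; rewrite (linearPt (tens_mul_linearl u)).1 !addr0.
Qed.

Lemma tens_scaleAr (a : K) (t u : T) : a *: (t * u) = t * (a *: u).
Proof.
by have := tens_mul_linearr t a u 0; rewrite (linearPt (tens_mul_linearr t)).1 !addr0.
Qed.

End TensorAlgebra.

Notation tens2 V := (tens (fun _ : 'I_2 => V)).
Notation tens3 V := (tens (fun _ : 'I_3 => V)).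

Section TensorSquare.
Variables (K : fieldType) (V : lmodType K).

Definition tprod2 (x y : V) : tens2 V := pure (tnth [tuple x; y]).
Definition tprod3 (x y z : V) : tens3 V := pure (tnth [tuple x; y; z]).

(* Sweedler summation: tlift2 f t = \sum f t^1 t^2 for t = \sum t^1 (x) t^2. *)
Definition tlift2 (W : lmodType K) (f : V -> V -> W) (t : tens2 V) : W :=
  tlift (fun x => f (x 0) (x 1)) t.

Definition tflip : tens2 V -> tens2 V := tlift2 (fun x y => tprod2 y x).

End TensorSquare.

Definition comult_l (K : fieldType) (V : lmodType K) (D : V -> tens2 V) :
    tens2 V -> tens3 V :=
  tlift2 (fun x y => tlift2 (fun x1 x2 => tprod3 x1 x2 y) (D x)).

Definition comult_r (K : fieldType) (V : lmodType K) (D : V -> tens2 V) :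
    tens2 V -> tens3 V :=
  tlift2 (fun x y => tlift2 (fun y1 y2 => tprod3 x y1 y2) (D y)).

Section TensorSquareTheory.
Variable K : fieldType.
Implicit Types V W U : lmodType K.

Definition bilin V W (f : V -> V -> W) : Prop :=
  (forall y, linear (f^~ y)) /\ (forall x, linear (f x)).

Lemma ord2E (P : 'I_2 -> Prop) : P 0 -> P 1 -> forall i, P i.
Proof.
move=> P0 P1 [[|[|//]] h].
  by rewrite (_ : Ordinal h = 0) //; apply: val_inj.
by rewrite (_ : Ordinal h = 1) //; apply: val_inj.
Qed.

Lemma ord3E (P : 'I_3 -> Prop) :
  P (@Ordinal 3 0 isT) -> P (@Ordinal 3 1 isT) -> P (@Ordinal 3 2 isT) ->
  forall i, P i.
Proof.
move=> P0 P1 P2 [[|[|[|//]]] h].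
- by rewrite (_ : Ordinal h = @Ordinal 3 0 isT) //; apply: val_inj.
- by rewrite (_ : Ordinal h = @Ordinal 3 1 isT) //; apply: val_inj.
- by rewrite (_ : Ordinal h = @Ordinal 3 2 isT) //; apply: val_inj.
Qed.

Lemma bilin_multilinear V W (f : V -> V -> W) : bilin f ->
  multilinear (fun x : forall _ : 'I_2, V => f (x 0) (x 1)).
Proof.
move=> [fl fr]; elim/ord2E => x a u v.
  rewrite !(dfwith_in x (i := 0)) !(dfwith_out x _ (_ : 0 != 1 :> 'I_2))//; exact: fl.
rewrite !(dfwith_in x (i := 1)) !(dfwith_out x _ (_ : 1 != 0 :> 'I_2))//; exact: fr.
Qed.

Lemma tlift2_linear V W (f : V -> V -> W) : bilin f -> linear (tlift2 f).
Proof. by move=> bf; apply: tlift_linear; exact: bilin_multilinear. Qed.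

Lemma tlift2_pure V W (f : V -> V -> W) (x : forall _ : 'I_2, V) : bilin f ->
  tlift2 f (pure x) = f (x 0) (x 1).
Proof. by move=> bf; rewrite /tlift2 tlift_pure//; exact: bilin_multilinear. Qed.

Lemma pure2E V (x : forall _ : 'I_2, V) : pure x = tprod2 (x 0) (x 1).
Proof. by congr pure; apply/funext; elim/ord2E. Qed.

Lemma tprod2_bilin V : bilin (@tprod2 K V).
Proof.
split=> [y|x] a u v.
  have E w : tprod2 w y = pure (dfwith (I := 'I_2) (fun _ => y) (i := 0) w).
    by congr pure; apply/funext; elim/ord2E; rewrite ?dfwith_in ?dfwith_out.
  by rewrite !E pure_multilinear.
have E w : tprod2 x w = pure (dfwith (I := 'I_2) (fun _ => x) (i := 1) w).
  by congr pure; apply/funext; elim/ord2E; rewrite ?dfwith_in ?dfwith_out.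
by rewrite !E pure_multilinear.
Qed.

Lemma tprod3_linear1 V (y z : V) : linear (fun w => tprod3 w y z).
Proof.
move=> a u v.
have E w : tprod3 w y z = pure (dfwith (tnth [tuple 0; y; z]) (i := @Ordinal 3 0 isT) w).
  by congr pure; apply/funext; elim/ord3E; rewrite ?dfwith_in ?dfwith_out.
by rewrite !E pure_multilinear.
Qed.

Lemma tprod3_linear2 V (x z : V) : linear (fun w => tprod3 x w z).
Proof.
move=> a u v.
have E w : tprod3 x w z = pure (dfwith (tnth [tuple x; 0; z]) (i := @Ordinal 3 1 isT) w).
  by congr pure; apply/funext; elim/ord3E; rewrite ?dfwith_in ?dfwith_out.
by rewrite !E pure_multilinear.
Qed.

Lemma tprod3_linear3 V (x y : V) : linear (fun w => tprod3 x y w).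
Proof.
move=> a u v.
have E w : tprod3 x y w = pure (dfwith (tnth [tuple x; y; 0]) (i := @Ordinal 3 2 isT) w).
  by congr pure; apply/funext; elim/ord3E; rewrite ?dfwith_in ?dfwith_out.
by rewrite !E pure_multilinear.
Qed.


Lemma tprod3_bilin12 V (z : V) : bilin (fun x y => tprod3 x y z).
Proof. by split=> w; [exact: tprod3_linear1|exact: tprod3_linear2]. Qed.

Lemma tprod3_bilin13 V (y : V) : bilin (fun x z => tprod3 x y z).
Proof. by split=> w; [exact: tprod3_linear1|exact: tprod3_linear3]. Qed.

Lemma tprod3_bilin23 V (x : V) : bilin (fun y z => tprod3 x y z).
Proof. by split=> w; [exact: tprod3_linear2|exact: tprod3_linear3]. Qed.

Lemma tflip_bilin V : bilin (fun x y : V => tprod2 y x).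
Proof. by have [l r] := tprod2_bilin V; split. Qed.

Lemma comult_l_bilin V (D : V -> tens2 V) : linear D ->
  bilin (fun x y => tlift2 (fun x1 x2 => tprod3 x1 x2 y) (D x)).
Proof.
move=> lD; split=> [y|x] a u v.
  by rewrite lD tlift2_linear//; exact: tprod3_bilin12.
by apply: tlift_comb => z; exact: tprod3_linear3.
Qed.

Lemma comult_r_bilin V (D : V -> tens2 V) : linear D ->
  bilin (fun x y => tlift2 (fun y1 y2 => tprod3 x y1 y2) (D y)).
Proof.
move=> lD; split=> [y|x] a u v.
  by apply: tlift_comb => z; exact: tprod3_linear1.
by rewrite lD tlift2_linear//; exact: tprod3_bilin23.
Qed.

Lemma tlift2_shuffle (I : finType) (V U : I -> lmodType K) W
    (F : tens V -> tens V -> W) (f : forall i, V i -> V i -> U i)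
    (G : (forall i, U i) -> W) :
  bilin F -> (forall i, bilin (f i)) -> multilinear G ->
  (forall x y, F (pure x) (pure y) = G (fun i => f i (x i) (y i))) ->
  forall t : forall i, tens2 (V i),
    tlift2 F (shuffle t) = G (fun i => tlift2 (f i) (t i)).
Proof.
move=> bF bf mG FG.
apply: (multilinear_ext (J := fun _ => 'I_2)).
- by apply: multilinear_post; [exact: shuffle_multilinear|exact: tlift2_linear].
- apply: (multilinear_comp (g := fun i => tlift2 (f i))) => // i.
  exact: tlift2_linear.
move=> y; rewrite shuffle_pure tlift2_pure// FG; congr G.
by apply: functional_extensionality_dep => i; rewrite tlift2_pure.
Qed.

Lemma multilinear_scale (I : finType) (V : I -> lmodType K) W
    (f : (forall i, V i) -> W) (c : I -> K) (x : forall i, V i) :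
  multilinear f -> f (fun i => c i *: x i) = (\prod_i c i) *: f x.
Proof.
move=> mf.
have H (s : seq I) : uniq s -> f (fun i => if i \in s then c i *: x i else x i)
    = (\prod_(i <- s) c i) *: f x.
  elim: s => [|i s IH] /=; first by rewrite big_nil scale1r.
  move=> /andP[is_ us]; set y := fun j => if j \in s then c j *: x j else x j.
  have -> : (fun j => if j \in i :: s then c j *: x j else x j) =
            dfwith y (c i *: x i + 0).
    apply: functional_extensionality_dep => j; rewrite inE addr0.
    case: (eqVneq j i) => [->|ji] /=; first by rewrite dfwith_in.
    by rewrite dfwith_out// eq_sym.
  have z : f (dfwith y (0 : V i)) = 0.
    by have := mf i y (-1) 0 0; rewrite scaler0 addr0 scaleN1r addNr.
  rewrite mf z addr0 big_cons -scalerA -IH//; congr (_ *: f _).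
  have -> : x i = y i by rewrite /y (negPf is_).
  exact: dfwith_same.
have := H (enum I) (enum_uniq I).
rewrite big_enum => <-; congr f.
by apply: functional_extensionality_dep => i; rewrite mem_enum.
Qed.

Lemma shuffle_tprod2 (I : finType) (V : I -> lmodType K) (x y : forall i, V i) :
  shuffle (fun i => tprod2 (x i) (y i)) = tprod2 (pure x) (pure y).
Proof. by rewrite shuffle_pure pure2E. Qed.

Lemma shuffle_tprod3 (I : finType) (V : I -> lmodType K) (x y z : forall i, V i) :
  shuffle (fun i => tprod3 (x i) (y i) (z i)) = tprod3 (pure x) (pure y) (pure z).
Proof.
by rewrite shuffle_pure; congr pure; apply/funext; elim/ord3E.
Qed.

Lemma prod_multilinear (I : finType) (V : I -> lmodType K)
    (f : forall i, V i -> K^o) : (forall i, linear (f i)) ->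
  multilinear (fun x : forall i, V i => \prod_i f i (x i) : K^o).
Proof.
move=> lf i x a u v; rewrite !(bigD1 (P := predT) i)//= !dfwith_in lf.
rewrite [in LHS](eq_bigr (fun j => f j (x j))); last first.
  by move=> j ji; rewrite dfwith_out// eq_sym.
rewrite [in X in _ = a *: (_ * X) + _](eq_bigr (fun j => f j (x j))); last first.
  by move=> j ji; rewrite dfwith_out// eq_sym.
rewrite [in X in _ = _ + (_ * X)](eq_bigr (fun j => f j (x j))); last first.
  by move=> j ji; rewrite dfwith_out// eq_sym.
by rewrite mulrDl /GRing.scale /= mulrA.
Qed.

End TensorSquareTheory.

Record hopf_axioms (K : fieldType) (H : algType K)
    (D : H -> tens2 H) (e : H -> K^o) (S : H -> H) : Prop := HopfAxioms {
  comult_linear : linear D;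
  comult_monoid : monoid_morphism D;
  counit_linear : linear e;
  counit_monoid : monoid_morphism e;
  antipode_linear : linear S;
  coassoc : forall x, comult_l D (D x) = comult_r D (D x);
  counitl : forall x, tlift2 (fun a b => e a *: b) (D x) = x;
  counitr : forall x, tlift2 (fun a b => e b *: a) (D x) = x;
  antipodel : forall x, tlift2 (fun a b => S a * b) (D x) = (e x)%:A;
  antipoder : forall x, tlift2 (fun a b => a * S b) (D x) = (e x)%:A
}.

Record hopfAlg (K : fieldType) := HopfAlg {
  hopf_alg :> algType K;
  comult : hopf_alg -> tens2 hopf_alg;
  counit : hopf_alg -> K^o;
  antipode : hopf_alg -> hopf_alg;
  hopfP : hopf_axioms comult counit antipode
}.

Section Legs.
Variables (K : fieldType) (H : algType K).
Definition leg12 : tens2 H -> tens3 H := tlift2 (fun x y => tprod3 x y 1).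
Definition leg13 : tens2 H -> tens3 H := tlift2 (fun x y => tprod3 x 1 y).
Definition leg23 : tens2 H -> tens3 H := tlift2 (fun x y => tprod3 1 x y).
End Legs.

(* Drinfeld's axioms, with the convention R D(x) R^-1 = D^op(x). *)
Record quasitriangular (K : fieldType) (H : algType K)
    (D : H -> tens2 H) (R : tens2 H) : Prop := Quasitriangular {
  qt_inv : exists R', R * R' = 1 /\ R' * R = 1;
  qt_flip : forall x, R * D x = tflip (D x) * R;
  qt_comult_l : comult_l D R = leg13 R * leg23 R;
  qt_comult_r : comult_r D R = leg13 R * leg12 R
}.

Record qtHopfAlg (K : fieldType) := QtHopfAlg {
  qt_hopf :> hopfAlg K;
  univR : tens2 qt_hopf;
  qtP : quasitriangular (@comult K qt_hopf) univR
}.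

Section TensorHopf.
Variables (K : fieldType) (I : finType).

Section Hopf.
Variable H : I -> hopfAlg K.
Local Notation T := (tens (fun i => H i : lmodType K)).

Definition tens_comult (t : T) : tens2 T :=
  tlift (fun h => shuffle (fun i => comult (h i))) t.

Definition tens_counit (t : T) : K^o :=
  tlift (fun h => \prod_i counit (h i) : K^o) t.

Definition tens_antipode (t : T) : T :=
  tlift (fun h => pure (fun i => antipode (h i))) t.

Fact comult_multilinear :
  multilinear (fun h : forall i, H i => shuffle (fun i => comult (h i))).
Proof.
apply: (multilinear_comp (g := fun i => @comult K (H i))).
  by move=> i; exact: comult_linear (hopfP (H i)).
exact: shuffle_multilinear.
Qed.

Fact counit_multilinear :
  multilinear (fun h : forall i, H i => \prod_i counit (h i) : K^o).
Proof.
apply: (prod_multilinear (f := fun i => @counit K (H i))).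
by move=> i; exact: counit_linear (hopfP (H i)).
Qed.

Fact antipode_multilinear :
  multilinear (fun h : forall i, H i => pure (fun i => antipode (h i)) : T).
Proof.
apply: (multilinear_comp (g := fun i => @antipode K (H i))).
  by move=> i; exact: antipode_linear (hopfP (H i)).
exact: pure_multilinear.
Qed.

Lemma tens_counit_one : tens_counit 1 = 1.
Proof.
rewrite /tens_counit tlift_pure; last exact: counit_multilinear.
by rewrite big1// => i _; rewrite (counit_monoid (hopfP (H i))).1.
Qed.

Fact tens_counit_linear : linear tens_counit.
Proof. exact: tlift_linear counit_multilinear. Qed.

Fact tens_one_neq0 : (1 : T) != 0.
Proof.
apply/eqP => e; have := tens_counit_one; rewrite e.
rewrite (linearPt tens_counit_linear).1 => /esym/eqP.
by rewrite (negPf (oner_neq0 K)).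
Qed.

HB.instance Definition _ := GRing.PzSemiRing_isNonZero.Build T tens_one_neq0.
HB.instance Definition _ := GRing.Lmodule_isLalgebra.Build K T (@tens_scaleAl K I H).
HB.instance Definition _ := GRing.Lalgebra_isAlgebra.Build K T (@tens_scaleAr K I H).

Fact tens_comult_linear : linear tens_comult.
Proof. exact: tlift_linear comult_multilinear. Qed.

Fact tens_antipode_linear : linear tens_antipode.
Proof. exact: tlift_linear antipode_multilinear. Qed.

Lemma tens_comult_pure h : tens_comult (pure h) = shuffle (fun i => comult (h i)).
Proof. exact: tlift_pure comult_multilinear h. Qed.

Lemma tens_counit_pure h : tens_counit (pure h) = \prod_i counit (h i).
Proof. exact: tlift_pure counit_multilinear h. Qed.

Lemma tens_antipode_pure h : tens_antipode (pure h) = pure (fun i => antipode (h i)).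
Proof. exact: tlift_pure antipode_multilinear h. Qed.

Lemma shuffle_one (J : finType) :
  shuffle (fun i => 1 : tens (fun _ : J => H i)) = 1 :> tens (fun _ : J => T).
Proof. exact: shuffle_pure. Qed.

Lemma shuffleM (J : finType) (t u : forall i, tens (fun _ : J => H i)) :
  shuffle (fun i => t i * u i) = shuffle t * shuffle u :> tens (fun _ : J => T).
Proof.
move: t; apply: multilinear_ext.
- apply: (multilinear_comp (g := fun i (t : tens (fun _ : J => H i)) => t * u i) (f := @shuffle K I J _)); last exact: shuffle_multilinear.
  by move=> i a v w; exact: tens_mul_linearl.
- apply: (multilinear_post (f := @shuffle K I J _) (h := fun t : tens (fun _ : J => T) => t * shuffle u)).
    exact: shuffle_multilinear.
  by move=> a v w; exact: tens_mul_linearl.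
move=> y; move: u; apply: multilinear_ext.
- apply: (multilinear_comp (g := fun i (u : tens (fun _ : J => H i)) => pure (y i) * u) (f := @shuffle K I J _)).
    by move=> i a v w; exact: tens_mul_linearr.
  exact: shuffle_multilinear.
- apply: (multilinear_post (f := @shuffle K I J _) (h := fun u : tens (fun _ : J => T) => shuffle (fun i => pure (y i)) * u)).
    exact: shuffle_multilinear.
  by move=> a v w; exact: tens_mul_linearr.
move=> z; rewrite !shuffle_pure tens_mulE.
rewrite (_ : (fun i => pure (y i) * pure (z i)) =
             fun i => pure (fun j => y i j * z i j)); last first.
  by apply: functional_extensionality_dep => i; rewrite tens_mulE.
rewrite shuffle_pure; congr pure; apply: functional_extensionality_dep => j.
by rewrite tens_mulE.
Qed.

Fact tens_comult_monoid : monoid_morphism tens_comult.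
Proof.
split=> [|t u].
  rewrite tens_comult_pure -shuffle_one; congr shuffle.
  by apply: functional_extensionality_dep => i; rewrite (comult_monoid (hopfP (H i))).1.
move: t; apply: tens_lin_ext.
- by move=> a v w; rewrite -tens_comult_linear tens_scaleAl -mulrDl.
- by move=> a v w; rewrite tens_comult_linear mulrDl tens_scaleAl.
move=> x; move: u; apply: tens_lin_ext.
- by move=> a v w; rewrite -tens_comult_linear tens_scaleAr -mulrDr.
- by move=> a v w; rewrite tens_comult_linear mulrDr tens_scaleAr.
move=> y; rewrite tens_mulE !tens_comult_pure -shuffleM; congr shuffle.
by apply: functional_extensionality_dep => i; rewrite (comult_monoid (hopfP (H i))).2.
Qed.

Fact tens_counit_monoid : monoid_morphism tens_counit.
Proof.
split=> [|t u]; first exact: tens_counit_one.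
move: t; apply: tens_lin_ext.
- by move=> a v w; rewrite -tens_counit_linear tens_scaleAl -mulrDl.
- by move=> a v w; rewrite tens_counit_linear mulrDl scalerAl.
move=> x; move: u; apply: tens_lin_ext.
- by move=> a v w; rewrite -tens_counit_linear tens_scaleAr -mulrDr.
- by move=> a v w; rewrite tens_counit_linear mulrDr scalerAr.
move=> y; rewrite tens_mulE !tens_counit_pure -big_split; apply: eq_bigr => i _.
by rewrite (counit_monoid (hopfP (H i))).2.
Qed.

Lemma comult_l_shuffle (t : forall i, tens2 (H i)) :
  comult_l tens_comult (shuffle t) = shuffle (fun i => comult_l (@comult K (H i)) (t i)).
Proof.
apply: (tlift2_shuffle
  (f := fun i x y => tlift2 (fun x1 x2 => tprod3 x1 x2 y) (comult x)) (G := @shuffle _ _ _ _)).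
- exact/comult_l_bilin/tens_comult_linear.
- by move=> i; apply/comult_l_bilin/(comult_linear (hopfP (H i))).
- exact: shuffle_multilinear.
move=> x y; rewrite tens_comult_pure.
apply: (tlift2_shuffle (f := fun i x1 x2 => tprod3 x1 x2 (y i)) (G := @shuffle _ _ _ _)).
- exact: tprod3_bilin12.
- by move=> i; exact: tprod3_bilin12.
- exact: shuffle_multilinear.
by move=> u v; rewrite shuffle_tprod3.
Qed.

Lemma comult_r_shuffle (t : forall i, tens2 (H i)) :
  comult_r tens_comult (shuffle t) = shuffle (fun i => comult_r (@comult K (H i)) (t i)).
Proof.
apply: (tlift2_shuffle
  (f := fun i x y => tlift2 (fun y1 y2 => tprod3 x y1 y2) (comult y)) (G := @shuffle _ _ _ _)).
- exact/comult_r_bilin/tens_comult_linear.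
- by move=> i; apply/comult_r_bilin/(comult_linear (hopfP (H i))).
- exact: shuffle_multilinear.
move=> x y; rewrite tens_comult_pure.
apply: (tlift2_shuffle (f := fun i y1 y2 => tprod3 (x i) y1 y2) (G := @shuffle _ _ _ _)).
- exact: tprod3_bilin23.
- by move=> i; exact: tprod3_bilin23.
- exact: shuffle_multilinear.
by move=> u v; rewrite shuffle_tprod3.
Qed.

Lemma pure_scale (c : I -> K) (x : forall i, H i) :
  pure (fun i => c i *: x i) = (\prod_i c i) *: pure x :> T.
Proof. by rewrite multilinear_scale//; exact: pure_multilinear. Qed.

Section BilinHopf.
Variables (A : algType K) (e : A -> K^o) (S : A -> A).
Hypotheses (le : linear e) (lS : linear S).

Lemma bilin_counitl : bilin (fun a b : A => e a *: b).
Proof.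
split=> [y|x] a u v; first by rewrite le scalerDl scalerA.
by rewrite scalerDr !scalerA mulrC.
Qed.

Lemma bilin_counitr : bilin (fun a b : A => e b *: a).
Proof. by have [l r] := bilin_counitl; split. Qed.

Lemma bilin_antipodel : bilin (fun a b : A => S a * b).
Proof.
split=> [y|x] a u v; first by rewrite lS mulrDl scalerAl.
by rewrite mulrDr scalerAr.
Qed.

Lemma bilin_antipoder : bilin (fun a b : A => a * S b).
Proof.
split=> [y|x] a u v; first by rewrite mulrDl scalerAl.
by rewrite lS mulrDr scalerAr.
Qed.
End BilinHopf.

Lemma tens_hopfP : hopf_axioms tens_comult tens_counit tens_antipode.
Proof.
split.
- exact: tens_comult_linear.
- exact: tens_comult_monoid.
- exact: tens_counit_linear.
- exact: tens_counit_monoid.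
- exact: tens_antipode_linear.
- apply: tens_lin_ext.
  + move=> a u v; rewrite tens_comult_linear /comult_l tlift2_linear//.
    exact/comult_l_bilin/tens_comult_linear.
  + move=> a u v; rewrite tens_comult_linear /comult_r tlift2_linear//.
    exact/comult_r_bilin/tens_comult_linear.
  move=> h; rewrite tens_comult_pure comult_l_shuffle comult_r_shuffle; congr shuffle.
  by apply: functional_extensionality_dep => i; rewrite (coassoc (hopfP (H i))).
- apply: tens_lin_ext => [a u v|//|h].
    by rewrite tens_comult_linear tlift2_linear//; exact/bilin_counitl/tens_counit_linear.
  rewrite tens_comult_pure.
  rewrite (tlift2_shuffle (f := fun i a b => counit a *: b) (G := @pure _ _ _)).
  + by congr pure; apply: functional_extensionality_dep => i; exact: (counitl (hopfP (H i))).
  + exact/bilin_counitl/tens_counit_linear.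
  + by move=> i; apply/bilin_counitl/(counit_linear (hopfP (H i))).
  + exact: pure_multilinear.
  by move=> x y; rewrite tens_counit_pure pure_scale.
- apply: tens_lin_ext => [a u v|//|h].
    by rewrite tens_comult_linear tlift2_linear//; exact/bilin_counitr/tens_counit_linear.
  rewrite tens_comult_pure.
  rewrite (tlift2_shuffle (f := fun i a b => counit b *: a) (G := @pure _ _ _)).
  + by congr pure; apply: functional_extensionality_dep => i; exact: (counitr (hopfP (H i))).
  + exact/bilin_counitr/tens_counit_linear.
  + by move=> i; apply/bilin_counitr/(counit_linear (hopfP (H i))).
  + exact: pure_multilinear.
  by move=> x y; rewrite tens_counit_pure pure_scale.
- apply: tens_lin_ext => [a u v|a u v|h].
  + by rewrite tens_comult_linear tlift2_linear//; exact/bilin_antipodel/tens_antipode_linear.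
  + by rewrite tens_counit_linear scalerDl scalerA.
  rewrite tens_comult_pure.
  rewrite (tlift2_shuffle (f := fun i a b => antipode a * b) (G := @pure _ _ _)).
  + rewrite tens_counit_pure -pure_scale.
    by congr pure; apply: functional_extensionality_dep => i; exact: (antipodel (hopfP (H i))).
  + exact/bilin_antipodel/tens_antipode_linear.
  + by move=> i; apply/bilin_antipodel/(antipode_linear (hopfP (H i))).
  + exact: pure_multilinear.
  by move=> x y; rewrite tens_antipode_pure tens_mulE.
- apply: tens_lin_ext => [a u v|a u v|h].
  + by rewrite tens_comult_linear tlift2_linear//; exact/bilin_antipoder/tens_antipode_linear.
  + by rewrite tens_counit_linear scalerDl scalerA.
  rewrite tens_comult_pure.
  rewrite (tlift2_shuffle (f := fun i a b => a * antipode b) (G := @pure _ _ _)).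
  + rewrite tens_counit_pure -pure_scale.
    by congr pure; apply: functional_extensionality_dep => i; exact: (antipoder (hopfP (H i))).
  + exact/bilin_antipoder/tens_antipode_linear.
  + by move=> i; apply/bilin_antipoder/(antipode_linear (hopfP (H i))).
  + exact: pure_multilinear.
  by move=> x y; rewrite tens_antipode_pure tens_mulE.
Qed.

Definition tens_hopf : hopfAlg K := HopfAlg tens_hopfP.

End Hopf.

Section Quasitriangular.
Variable H : I -> qtHopfAlg K.
Local Notation T := (tens_hopf H).

(* (R_1^1 (x) ... (x) R_n^1) (x) (R_1^2 (x) ... (x) R_n^2) *)
Definition tens_univR : tens2 T := shuffle (fun i => univR (H i)).

Lemma leg_shuffle (f : forall i, H i -> H i -> tens3 (H i)) (F : T -> T -> tens3 T)
    (t : forall i, tens2 (H i)) :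
  (forall i, bilin (f i)) -> bilin F ->
  (forall x y, F (pure x) (pure y) = shuffle (fun i => f i (x i) (y i))) ->
  tlift2 F (shuffle t) = shuffle (fun i => tlift2 (f i) (t i)).
Proof.
move=> bf bF e.
by apply: (tlift2_shuffle (G := @shuffle _ _ _ _)) => //; exact: shuffle_multilinear.
Qed.

Lemma leg12_shuffle (t : forall i, tens2 (H i)) :
  leg12 (shuffle t : tens2 T) = shuffle (fun i => leg12 (t i)).
Proof.
apply: (leg_shuffle (f := fun i x y => tprod3 x y 1)).
- by move=> i; exact: tprod3_bilin12.
- exact: tprod3_bilin12.
by move=> x y; rewrite shuffle_tprod3.
Qed.

Lemma leg13_shuffle (t : forall i, tens2 (H i)) :
  leg13 (shuffle t : tens2 T) = shuffle (fun i => leg13 (t i)).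
Proof.
apply: (leg_shuffle (f := fun i x y => tprod3 x 1 y)).
- by move=> i; exact: tprod3_bilin13.
- exact: tprod3_bilin13.
by move=> x y; rewrite shuffle_tprod3.
Qed.

Lemma leg23_shuffle (t : forall i, tens2 (H i)) :
  leg23 (shuffle t : tens2 T) = shuffle (fun i => leg23 (t i)).
Proof.
apply: (leg_shuffle (f := fun i x y => tprod3 1 x y)).
- by move=> i; exact: tprod3_bilin23.
- exact: tprod3_bilin23.
by move=> x y; rewrite shuffle_tprod3.
Qed.

Lemma tflip_shuffle (t : forall i, tens2 (H i)) :
  tflip (shuffle t : tens2 T) = shuffle (fun i => tflip (t i)).
Proof.
apply: (tlift2_shuffle (f := fun i x y => tprod2 y x) (G := @shuffle _ _ _ _)).
- exact: tflip_bilin.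
- by move=> i; exact: tflip_bilin.
- exact: shuffle_multilinear.
by move=> x y; rewrite shuffle_tprod2.
Qed.

Lemma tens_qtP : quasitriangular (@comult K T) tens_univR.
Proof.
split.
- have c i := cid (qt_inv (qtP (H i))).
  exists (shuffle (fun i => sval (c i))); split.
    rewrite -shuffleM -shuffle_one; congr shuffle.
    by apply: functional_extensionality_dep => i; case: (c i) => ? [].
  rewrite -shuffleM -shuffle_one; congr shuffle.
  by apply: functional_extensionality_dep => i; case: (c i) => ? [].
- apply: tens_lin_ext.
  + by move=> a u v; rewrite /= tens_comult_linear mulrDr tens_scaleAr.
  + move=> a u v; rewrite /= tens_comult_linear.
    by rewrite /tflip (tlift2_linear (@tflip_bilin _ _)) mulrDl tens_scaleAl.
  move=> h; rewrite /= tens_comult_pure tflip_shuffle -!shuffleM; congr shuffle.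
  by apply: functional_extensionality_dep => i; rewrite (qt_flip (qtP (H i))).
- rewrite comult_l_shuffle leg13_shuffle leg23_shuffle -shuffleM; congr shuffle.
  by apply: functional_extensionality_dep => i; rewrite (qt_comult_l (qtP (H i))).
- rewrite comult_r_shuffle leg13_shuffle leg12_shuffle -shuffleM; congr shuffle.
  by apply: functional_extensionality_dep => i; rewrite (qt_comult_r (qtP (H i))).
Qed.

Definition tens_qtHopf : qtHopfAlg K := QtHopfAlg tens_qtP.

End Quasitriangular.
End TensorHopf.

Record is_rep (K : fieldType) (H : algType K) (V : lmodType K)
    (T : H -> V -> V) : Prop := IsRep {
  rep_linearl : forall v, linear (T^~ v);
  rep_linearr : forall h, linear (T h);
  rep_one : forall v, T 1 v = v;
  rep_mul : forall g h v, T (g * h) v = T g (T h v)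
}.

Record rep (K : fieldType) (H : algType K) (V : lmodType K) := Rep {
  rep_act :> H -> V -> V;
  repP : is_rep rep_act
}.

Section TensorRep.
Variables (K : fieldType) (I : finType).
Variables (H : I -> qtHopfAlg K) (V : I -> lmodType K).
Variable T : forall i, rep (H i) (V i).

Definition tens_act (t : tens_qtHopf H) (w : tens V) : tens V :=
  tlift (fun h => tlift (fun v => pure (fun i => T i (h i) (v i))) w) t.

Fact act_multilinearr (h : forall i, H i) :
  multilinear (fun v : forall i, V i => pure (fun i => T i (h i) (v i))).
Proof.
apply: (multilinear_comp (g := fun i v => T i (h i) v)); last exact: pure_multilinear.
by move=> i; exact: rep_linearr (repP (T i)) _.
Qed.

Fact act_multilinearl (w : tens V) :
  multilinear (fun h : forall i, H i =>
    tlift (fun v => pure (fun i => T i (h i) (v i))) w).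
Proof.
move=> i x a u v; apply: tlift_comb => y.
apply: (multilinear_comp (g := fun i h => T i h (y i))); last exact: pure_multilinear.
by move=> j; exact: rep_linearl (repP (T j)) _.
Qed.

Lemma tens_act_pure (h : forall i, H i) (v : forall i, V i) :
  tens_act (pure h) (pure v) = pure (fun i => T i (h i) (v i)).
Proof.
rewrite /tens_act tlift_pure; last exact: act_multilinearl.
by rewrite tlift_pure//; exact: act_multilinearr.
Qed.

Lemma tens_act_linearl w : linear (tens_act^~ w).
Proof. exact: (tlift_linear (act_multilinearl w)). Qed.

Lemma tens_act_linearr t : linear (tens_act t).
Proof.
by move=> a u v; apply: tlift_comb => h; exact: (tlift_linear (act_multilinearr h)).
Qed.

Lemma tens_repP : is_rep tens_act.
Proof.
split; [exact: tens_act_linearl|exact: tens_act_linearr| |].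
  apply: tens_lin_ext; [exact: tens_act_linearr|by []|] => v.
  rewrite tens_act_pure; congr pure; apply: functional_extensionality_dep => i.
  exact: rep_one (repP (T i)) _.
move=> g h v; move: g; apply: tens_lin_ext.
- by move=> a x y; rewrite mulrDl -scalerAl tens_act_linearl.
- by move=> a x y; rewrite tens_act_linearl.
move=> x; move: h; apply: tens_lin_ext.
- by move=> a y z; rewrite mulrDr -scalerAr tens_act_linearl.
- by move=> a y z; rewrite tens_act_linearl tens_act_linearr.
move=> y; move: v; apply: tens_lin_ext.
- exact: tens_act_linearr.
- by move=> a u v; rewrite !tens_act_linearr.
move=> v; rewrite [_ * _]tens_mulE !tens_act_pure; congr pure.
apply: functional_extensionality_dep => i; exact: rep_mul (repP (T i)) _ _ _.
Qed.

Definition tens_rep : rep (tens_qtHopf H) (tens V) := Rep tens_repP.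

End TensorRep.

Section RMatrix.
Variables (K : fieldType).

Definition is_basis (V : lmodType K) (J : finType) (e : J -> V) : Prop :=
  forall v, exists! c : {ffun J -> K}, v = \sum_j c j *: e j.

Definition tens_basis (I : finType) (V : I -> lmodType K) (J : I -> finType)
    (e : forall i, J i -> V i) (j : {dffun forall i, J i}) : tens V :=
  pure (fun i => e i (j i)).

(* R_V = (T (x) T)(R_H), as an operator on V (x) V. *)
Definition Rop (H : qtHopfAlg K) (V : lmodType K) (T : rep H V)
    (w : tens2 V) : tens2 V :=
  tlift2 (fun a b => tlift2 (fun u v => tprod2 (T a u) (T b v)) w) (univR H).

(* M i j k l is the entry in row (i, j) and column (k, l). *)
Definition has_entries (V : lmodType K) (J : finType) (e : J -> V)
    (R : tens2 V -> tens2 V) (M : J -> J -> J -> J -> K) : Prop :=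
  forall k l, R (tprod2 (e k) (e l)) =
    \sum_i \sum_j M i j k l *: tprod2 (e i) (e j).

(* The matrix of R in the basis of V (x) V induced by e; it is unique when e is
   a basis of V (and 0 is a default value when there is none). *)
Definition entries (V : lmodType K) (J : finType) (e : J -> V)
    (R : tens2 V -> tens2 V) : J -> J -> J -> J -> K :=
  xget (fun _ _ _ _ => 0) [set M | has_entries e R M]%classic.

End RMatrix.

(* Main.v *)
(* The matrix entries of R are obtained by applying to R(e_k (x) e_l) the
   functional e_i^* (x) e_j^*, where e^* is the dual basis.  The dual basis of
   the tensor product basis consists of the products of the dual bases of the
   factors, and R_{V_1 (x) ... (x) V_n} is, up to reordering the tensor factors,
   the factorwise action of the R_{V_a}; hence the entries multiply. *)
Require Import Defs.
From mathcomp Require Import all_boot all_order all_algebra.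
From mathcomp Require Import boolp classical_sets.

Import GRing.Theory.
Local Open Scope ring_scope.

Set Implicit Arguments.
Unset Strict Implicit.
Unset Printing Implicit Defensive.

Lemma linear_sumE (K : fieldType) (V W : lmodType K) (f : V -> W)
    (J : finType) (v : J -> V) :
  linear f -> f (\sum_j v j) = \sum_j f (v j).
Proof.
move=> lf; elim/big_rec2: _ => [|j x y _ <-]; first exact: (linearPt lf).1.
by have := lf 1 (v j) y; rewrite !scale1r.
Qed.

Lemma linear_suml (K : fieldType) (V W : lmodType K) (f : V -> W)
    (J : finType) (a : J -> K) (v : J -> V) :
  linear f -> f (\sum_j a j *: v j) = \sum_j a j *: f (v j).
Proof.
move=> lf; rewrite linear_sumE//; apply: eq_bigr => j _.
by have := lf (a j) (v j) 0; rewrite (linearPt lf).1 !addr0.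
Qed.

Lemma sum_delta (K : fieldType) (W : lmodType K) (J : finType) (F : J -> W) k :
  \sum_j (j == k)%:R *: F j = F k.
Proof.
rewrite (bigD1 k)//= eqxx scale1r big1 ?addr0// => j /negPf ->.
by rewrite scale0r.
Qed.

(** Expanding one argument at a time in the spanning family replaces arbitrary vectors by basis
    vectors, slot after slot. *)
Lemma multilinear_basis_ext (K : fieldType) (I : finType) (V : I -> lmodType K)
    (W : lmodType K) (J : I -> finType) (e : forall a, J a -> V a)
    (f g : (forall a, V a) -> W) :
  (forall a v, exists c : J a -> K, v = \sum_j c j *: e a j) ->
  multilinear f -> multilinear g ->
  (forall k : {dffun forall a, J a},
     f (fun a => e a (k a)) = g (fun a => e a (k a))) ->
  forall x, f x = g x.
Proof.
move=> he mf mg fg.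
(* [s] lists the slots whose vectors are still arbitrary; it starts as all of [I]. *)
suff H (s : seq I) (x : forall a, V a) :
    (forall a, a \notin s -> exists j, x a = e a j) -> f x = g x.
  by move=> x; apply: (H (enum I)) => a; rewrite mem_enum.
elim: s x => [|a s IH] x hx.
  have c a := cid (hx a isT).
  rewrite (_ : x = fun a => e a ([ffun a => sval (c a)] a : J a)).
    exact: (fg [ffun a => sval (c a)]).
  by apply: functional_extensionality_dep => a; rewrite ffunE; case: (c a).
(* Taking the scalar -1 and two zero vectors in multilinearity gives the value at a zero slot, which
   settles the empty sum below. *)
have z h : multilinear h -> h (dfwith x (0 : V a)) = 0 :> W.
  by move=> /(_ a x (-1) 0 0); rewrite scaler0 addr0 scaleN1r addNr.
rewrite -(dfwith_same x a); have [c ->] := he a (x a).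
elim/big_rec: _ => [|j v _ fgv]; first by rewrite !z.
rewrite mf mg fgv IH// => b bs; case: (eqVneq a b) => [<-|ab].
  by exists j; rewrite dfwith_in.
by rewrite dfwith_out//; apply: hx; rewrite inE negb_or eq_sym ab.
Qed.

(** Coordinates are packaged as functionals into [K^o], so that a coefficient is obtained by
    evaluation instead of through the unique existence in [is_basis]. *)
Definition dual_basis (K : fieldType) (V : lmodType K) (J : finType)
    (e : J -> V) (c : J -> V -> K^o) : Prop :=
  [/\ forall j, linear (c j), forall v, v = \sum_j c j v *: e j
    & forall i j, c i (e j) = (i == j)%:R].

(** Coordinates are picked by choice; their uniqueness yields both linearity and the Kronecker delta
    relations. *)
Lemma is_basis_dual (K : fieldType) (V : lmodType K) (J : finType) (e : J -> V) :
  is_basis e -> exists c, dual_basis e c.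
Proof.
move=> be; pose c v := sval (cid (be v)).
have cE v : v = \sum_j c v j *: e j by rewrite /c; case: (cid _) => ? /= [].
have cU v (d : {ffun J -> K}) : v = \sum_j d j *: e j -> c v = d.
  by move=> vd; rewrite /c; case: (cid _) => ? /= [_]; exact.
exists (fun j v => c v j); split=> [j a u v|//|i j].
  rewrite (cU _ [ffun j => a * c u j + c v j]) ?ffunE//.
  rewrite {1}(cE u) {1}(cE v) scaler_sumr -big_split; apply: eq_bigr => k _.
  by rewrite ffunE scalerDl scalerA.
rewrite (cU _ [ffun i => (i == j)%:R]) ?ffunE//.
rewrite -[LHS](sum_delta e); apply: eq_bigr => k _.
by rewrite ffunE.
Qed.

Section Entries.
Variables (K : fieldType) (V : lmodType K) (J : finType).
Variables (e : J -> V) (c : J -> V -> K^o).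
Hypothesis ec : dual_basis e c.

Lemma bilin_dual i j : bilin (fun u v => c i u * c j v : K^o).
Proof.
have [lc _ _] := ec; split=> [v|u] a x y; first by rewrite lc mulrDl scalerAl.
by rewrite lc mulrDr scalerAr.
Qed.

Lemma tlift2_tprod2 (W : lmodType K) (f : V -> V -> W) x y :
  bilin f -> tlift2 f (tprod2 x y) = f x y.
Proof. by move=> bf; rewrite tlift2_pure. Qed.

(** Both sides are linear in [w], so it suffices to expand each factor of a pure tensor in [e]. *)
Lemma tens2_dual_expand (w : tens2 V) :
  w = \sum_i \sum_j
    (tlift2 (fun u v => c i u * c j v : K^o) w : K) *: tprod2 (e i) (e j).
Proof.
move: w; apply: tens_lin_ext => [//|a u v|x].
  rewrite scaler_sumr -big_split; apply: eq_bigr => i _ /=.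
  rewrite scaler_sumr -big_split; apply: eq_bigr => j _ /=.
  by rewrite tlift2_linear; [rewrite scalerDl scalerA|exact: bilin_dual].
have [_ cE _] := ec; have [tl tr] := @tprod2_bilin K V.
rewrite pure2E {1}(cE (x 0)) (linear_suml (f := fun u => tprod2 u (x 1)))//.
apply: eq_bigr => i _; rewrite {1}(cE (x 1)) linear_suml// scaler_sumr.
apply: eq_bigr => j _; rewrite scalerA tlift2_tprod2//; exact: bilin_dual.
Qed.

Lemma entries_dual (R : tens2 V -> tens2 V) i j k l :
  entries e R i j k l =
  tlift2 (fun u v => c i u * c j v : K^o) (R (tprod2 (e k) (e l))).
Proof.
have [_ _ cd] := ec.
(* A matrix of [R] exists by [tens2_dual_expand], so [xget] returns a genuine one and not its
   default 0. *)
have : has_entries e R (entries e R).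
  rewrite /entries; apply: (@xgetPex _ _ [set M | has_entries e R M]%classic).
  exists (fun i j k l => tlift2 (fun u v => c i u * c j v : K^o) (R (tprod2 (e k) (e l)))).
  by move=> k' l'; exact: tens2_dual_expand.
move=> ->; have lphi := tlift2_linear (bilin_dual i j).
(* The entry on the left is spread into a double sum against Kronecker deltas, to be compared term
   by term with the image of the expansion. *)
rewrite linear_sumE// -[LHS](sum_delta (fun i' => entries e R i' j k l : K^o)).
apply: eq_bigr => i' _; rewrite linear_suml//.
rewrite -[X in _ *: X](sum_delta (fun j' => entries e R i' j' k l : K^o)) scaler_sumr.
apply: eq_bigr => j' _; rewrite tlift2_tprod2; last exact: bilin_dual.
rewrite !cd eq_sym (eq_sym j) /GRing.scale /=.
by rewrite mulrA mulrC.
Qed.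

End Entries.

Section TensorProduct.
Variables (K : fieldType) (I : finType) (V : I -> lmodType K).

Section DualBasis.
Variables (J : I -> finType) (e : forall a, J a -> V a).
Variable c : forall a, J a -> V a -> K^o.
Hypothesis ec : forall a, dual_basis (@e a) (@c a).

Definition tens_dual (j : {dffun forall a, J a}) : tens V -> K^o :=
  tlift (fun x => \prod_a c (j a) (x a) : K^o).

Lemma tens_dual_multilinear (j : {dffun forall a, J a}) :
  multilinear (fun x : forall a, V a => \prod_a c (j a) (x a) : K^o).
Proof.
by apply: (prod_multilinear (f := fun a => c (j a))) => a; have [] := ec a.
Qed.

Lemma tens_dual_pure j (x : forall a, V a) :
  tens_dual j (pure x) = \prod_a c (j a) (x a).
Proof. exact: tlift_pure (tens_dual_multilinear j) x. Qed.

Lemma tens_dual_basis_delta i j : tens_dual i (tens_basis e j) = (i == j)%:R.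
Proof.
rewrite tens_dual_pure; case: (eqVneq i j) => [->|ij].
  by rewrite big1// => a _; have [_ _ ->] := ec a; rewrite eqxx.
(* Distinct multi-indices differ at some [a], and the factor at [a] annihilates the product. *)
have /existsP[a ija] : [exists a, i a != j a].
  apply: contraR ij; rewrite negb_exists => /forallP ij; apply/eqP/ffunP => a.
  by apply/eqP; rewrite -[_ == _]negbK.
by rewrite (bigD1 a)//=; have [_ _ ->] := ec a; rewrite (negPf ija) mul0r.
Qed.

(** For the expansion, linearity reduces to pure tensors and multilinearity to families of basis
    vectors, where the delta relations leave a single term. *)
Lemma tens_dual_basis : dual_basis (tens_basis e) tens_dual.
Proof.
have ld j : linear (tens_dual j) := tlift_linear (tens_dual_multilinear j).
split; [exact: ld| |exact: tens_dual_basis_delta].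
apply: tens_lin_ext => [//|a u v|].
  rewrite scaler_sumr -big_split; apply: eq_bigr => j _ /=.
  by rewrite ld scalerDl scalerA.
apply: (multilinear_basis_ext (e := e)).
- by move=> a v; exists (fun j => c j v); have [_ + _] := ec a; apply.
- exact: pure_multilinear.
- move=> a x b u v; rewrite pure_multilinear.
  rewrite scaler_sumr -big_split; apply: eq_bigr => j _ /=.
  by rewrite ld scalerDl scalerA.
move=> k; rewrite -[LHS](sum_delta (tens_basis e)); apply: eq_bigr => j _.
by rewrite tens_dual_basis_delta.
Qed.

(** On pure tensors both sides are products over [a] of [c (i a) (x a) * c (j a) (y a)], grouped
    differently; [tlift2_shuffle] extends this to all [t]. *)
Lemma tens_dual_shuffle (i j : {dffun forall a, J a}) (t : forall a, tens2 (V a)) :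
  tlift2 (fun u v => tens_dual i u * tens_dual j v : K^o) (shuffle t) =
  \prod_a tlift2 (fun u v => c (i a) u * c (j a) v : K^o) (t a).
Proof.
apply: (tlift2_shuffle (U := fun _ => K^o)
  (f := fun a u v => c (i a) u * c (j a) v)
  (G := fun x : forall a : I, K^o => \prod_a x a : K^o)).
- exact: bilin_dual tens_dual_basis i j.
- by move=> a; exact: bilin_dual (ec a) (i a) (j a).
- exact: (prod_multilinear (V := fun _ => K^o) (f := fun _ => id)).
by move=> x y; rewrite !tens_dual_pure -big_split.
Qed.

End DualBasis.

Lemma bilin_tprod2_map (U W : lmodType K) (f g : U -> W) :
  linear f -> linear g -> bilin (fun u v => tprod2 (f u) (g v)).
Proof.
move=> lf lg; have [tl tr] := @tprod2_bilin K W.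
by split=> [v|u] a x y; [rewrite lf tl|rewrite lg tr].
Qed.

Lemma Rop_tprod2 (H : qtHopfAlg K) (U : lmodType K) (T : rep H U) u v :
  Rop T (tprod2 u v) = tlift2 (fun a b => tprod2 (T a u) (T b v)) (univR H).
Proof.
congr (tlift2 _ _); apply/funext => a; apply/funext => b.
rewrite tlift2_tprod2//; apply: bilin_tprod2_map; exact: rep_linearr (repP T) _.
Qed.

(** The universal R-matrix of the tensor product is by definition the shuffle of those of the
    factors, and pure elements act factorwise. *)
Lemma Rop_tens_rep (H : I -> qtHopfAlg K) (T : forall a, rep (H a) (V a))
    (x y : forall a, V a) :
  Rop (tens_rep T) (tprod2 (pure x) (pure y)) =
  shuffle (fun a => Rop (T a) (tprod2 (x a) (y a))).
Proof.
rewrite Rop_tprod2.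
under [X in shuffle X]functional_extensionality_dep do rewrite Rop_tprod2.
apply: (tlift2_shuffle (f := fun a g h => tprod2 (T a g (x a)) (T a h (y a)))
  (G := @shuffle _ _ _ _)).
- by apply: bilin_tprod2_map; exact: tens_act_linearl.
- by move=> a; apply: bilin_tprod2_map; exact: rep_linearl (repP (T a)) _.
- exact: shuffle_multilinear.
by move=> g h; rewrite shuffle_tprod2 /= !tens_act_pure.
Qed.

End TensorProduct.

Theorem proposition3p1 (K : fieldType) (n : nat) (H : 'I_n -> qtHopfAlg K)
    (m : 'I_n -> nat) (V : 'I_n -> lmodType K)
    (e : forall a : 'I_n, 'I_(m a) -> V a)
    (e_basis : forall a : 'I_n, is_basis (e a))
    (T : forall a : 'I_n, rep (H a) (V a))
    (i j k l : {dffun forall a : 'I_n, 'I_(m a)}) :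
  entries (tens_basis e) (Rop (tens_rep T)) i j k l =
  \prod_(a < n) entries (e a) (Rop (T a)) (i a) (j a) (k a) (l a).
Proof.
pose c a := sval (cid (is_basis_dual (e_basis a))).
have ec a : dual_basis (e a) (c a) by rewrite /c; case: (cid _).
(* The vectors [tens_basis e k] and [tens_basis e l] unfold to pure tensors, so [Rop_tens_rep]
   applies and the product functional then splits over the shuffle. *)
rewrite (entries_dual (tens_dual_basis ec)) Rop_tens_rep (tens_dual_shuffle ec).
by apply: eq_bigr => a _; rewrite (entries_dual (ec a)).
Qed.
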